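(* Let $f\in\mathbb{C}[Z]$ be a psd-stable polynomial on the space of complex symmetric $n\times n$ matrices. If an off-diagonal variable $z_{ij}$ (where $i<j$) occurs in $f$, then the corresponding diagonal variables $z_{ii}$ and $z_{jj}$ must also occur in $f$.
   Context: $\mathbb{C}[Z]$ denotes the ring of polynomials in the entries $z_{ij}$ of a symmetric $n\times n$ variable matrix $Z=(z_{ij})$, with $z_{ij}$ and $z_{ji}$ identified; equivalently, $\mathbb{C}[\{z_{ij} : 1\le i\le j\le n\}]$. A polynomial $f\in\mathbb{C}[Z]$ is psd-stable if $f(M)\ne 0$ for every complex symmetric $n\times n$ matrix $M$ whose entrywise imaginary part $\mathrm{Im}(M)$ is positive definite. A variable occurs in $f$ if it divides some monomial having non-zero coefficient in $f$. *)

(* Defs.v *)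
From mathcomp Require Import all_boot all_order all_algebra.
From mathcomp Require Import reals complex mpoly.

Set Implicit Arguments.
Unset Strict Implicit.
Unset Printing Implicit Defensive.

Import Order.TTheory GRing.Theory Num.Theory.

Local Open Scope ring_scope.

Definition upper_pair (n : nat) : predArgType :=
  {p : 'I_n * 'I_n | (p.1 <= p.2)%N}.

Definition sort_pair (n : nat) (i j : 'I_n) : 'I_n * 'I_n :=
  if (i <= j)%N then (i, j) else (j, i).

Lemma sort_pair_upper (n : nat) (i j : 'I_n) :
  ((sort_pair i j).1 <= (sort_pair i j).2)%N.
Proof. by rewrite /sort_pair; case: (leqP i j) => //= /ltnW. Qed.

(* Polynomials in the entries of a symmetric matrix of variables: [mpoly] wants
   its variables numbered, so z_ij is numbered by the rank of its sorted pair of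
   indices among all the pairs (i, j) with i <= j. *)
Notation nb_symvar n := #|{: upper_pair n}|.

Notation sympoly R n := {mpoly R[nb_symvar n]}.

(* z_ij and z_ji are the same variable. *)
Definition symvar (n : nat) (i j : 'I_n) : 'I_(nb_symvar n) :=
  enum_rank (exist _ (sort_pair i j) (sort_pair_upper i j) : upper_pair n).

(* Only the entries of M on and above the diagonal are read; this is the value
   f(M) when M is symmetric. *)
Definition sym_eval (R : comNzRingType) (n : nat) (f : sympoly R n)
    (M : 'M[R]_n) : R :=
  f.@[fun k => let p := val (enum_val k) in M p.1 p.2].

Lemma symvarC (n : nat) (i j : 'I_n) : symvar i j = symvar j i.
Proof.
rewrite /symvar; congr enum_rank; apply: val_inj => /=; rewrite /sort_pair.
by case: (ltngtP i j) => // /val_inj ->.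
Qed.

Lemma symvar_surj (n : nat) (k : 'I_(nb_symvar n)) :
  exists i : 'I_n, exists2 j : 'I_n, (i <= j)%N & symvar i j = k.
Proof.
exists (val (enum_val k)).1, (val (enum_val k)).2; first exact: (valP (enum_val k)).
apply: enum_val_inj; rewrite enum_rankK; apply: val_inj => /=.
by rewrite /sort_pair (valP (enum_val k)); case: (val _).
Qed.

Lemma sym_evalX (R : comNzRingType) (n : nat) (M : 'M[R]_n) (i j : 'I_n) :
  M^T = M -> sym_eval 'X_(symvar i j) M = M i j.
Proof.
move=> MT; rewrite /sym_eval mevalXU /symvar enum_rankK /= /sort_pair.
by case: ifP => //= _; rewrite -{1}MT mxE.
Qed.

Definition occurs (R : nzRingType) (N : nat) (k : 'I_N) (f : {mpoly R[N]}) :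
    Prop :=
  exists2 m : 'X_{1..N}, f@_m != 0 & (U_(k) <= m)%MM.

Definition posdefmx (R : realType) (n : nat) (A : 'M[R]_n) : Prop :=
  A^T = A /\ forall v : 'cV[R]_n, v != 0 -> 0 < (v^T *m A *m v) 0 0.

Definition psd_stable (R : realType) (n : nat) (f : sympoly R[i] n) : Prop :=
  forall M : 'M[R[i]]_n,
    M^T = M -> posdefmx (map_mx (@complex.Im R) M) -> sym_eval f M != 0.

(* Main.v *)
(** If z_ii does not occur in f, then f(M) does not depend on M_ii, whose
    imaginary part may be taken as large as one likes.  Hence M_ij is
    unconstrained as well: take Re M arbitrary and Im M = Id away from row and
    column i, and let M_ij = t be any complex number; the matrix Im M becomes
    positive definite once Im M_ii is large enough.  So for each choice of the
    other entries the univariate polynomial t |-> f(M) has no complex root and is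
    constant.  The other entries range over a product of infinite sets, on which a
    nonzero polynomial cannot vanish, so the coefficients of the positive powers
    of z_ij in f are all zero. *)

Require Import Defs.
From mathcomp Require Import all_boot all_order all_algebra.
From mathcomp Require Import reals complex mpoly.
From mathcomp Require Import ring zify.

Set Implicit Arguments.
Unset Strict Implicit.
Unset Printing Implicit Defensive.

Import Order.TTheory GRing.Theory Num.Theory.

Local Open Scope ring_scope.

Definition upd (T : eqType) (S : Type) (v : T -> S) (k : T) (t : S) : T -> S :=
  fun l => if l == k then t else v l.

Lemma poly0_inj_zeros (F : idomainType) (p : {poly F}) (h : nat -> F) :
  injective h -> (forall n, p.[h n] = 0) -> p = 0.
Proof.
move=> hI ph; apply/eqP; apply: contraT => p0.
have := @max_poly_roots _ p (mkseq h (size p)) p0.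
rewrite size_mkseq ltnn; apply.
  by apply/allP => _ /mapP[n _ ->]; apply/rootP.
by rewrite map_inj_uniq ?iota_uniq.
Qed.

Section PartialCoefficients.

Variables (N : nat) (F : idomainType).
Implicit Types (f : {mpoly F[N]}) (e : 'X_{1..N}) (s : seq 'I_N).
Implicit Types (k : 'I_N) (v : 'I_N -> F).

(* The value at v of the coefficient of prod_(k in s) z_k^(e k), f being viewed
   as a polynomial in the variables z_k, k in s, alone. *)
Definition pcoef f e s v : F :=
  \sum_(m <- msupp f | all (fun k => m k == e k) s)
    f@_m * \prod_(l | l \notin s) v l ^+ m l.

(** The coefficient taken by [pcoef], with z_k left as the indeterminate instead of being evaluated
    at [v k]. *)
Definition pcoef_poly f e s k v : {poly F} :=
  \sum_(m <- msupp f | all (fun k => m k == e k) s)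
    (f@_m * \prod_(l | l \notin k :: s) v l ^+ m l) *: 'X^(m k).

Lemma pcoef_nil f e v : pcoef f e [::] v = f.@[v].
Proof. by rewrite mevalE /pcoef; apply: eq_bigr. Qed.

Lemma eq_pcoef f e s s' v : s =i s' -> pcoef f e s v = pcoef f e s' v.
Proof.
move=> ss'; rewrite /pcoef; apply: eq_big => [m|m _]; first exact: eq_all_r.
by congr (_ * _); apply: eq_bigl => l; rewrite ss'.
Qed.

Lemma pcoef_enum f e v : pcoef f e (enum 'I_N) v = f@_e.
Proof.
have allE (m : 'X_{1..N}) : all (fun k => m k == e k) (enum 'I_N) = (m == e).
  apply/allP/eqP => [me|-> //]; apply/mnmP => k.
  by apply/eqP/me; rewrite mem_enum.
rewrite /pcoef (eq_bigl _ _ allE) -big_filter.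
have [ef|eNf] := boolP (e \in msupp f).
  rewrite filter_pred1_uniq // big_seq1 big_pred0 ?mulr1 // => l.
  by rewrite mem_enum.
rewrite big_filter big_seq_cond big1 => [|m /andP[mf /eqP me]].
  by apply/esym/eqP; rewrite mcoeff_eq0.
by rewrite -me mf in eNf.
Qed.

Lemma coef_pcoef_poly f e s k v :
  (pcoef_poly f e s k v)`_(e k) = pcoef f e (k :: s) v.
Proof.
rewrite coef_sum /pcoef /= big_mkcond [RHS]big_mkcond.
apply: eq_bigr => m _ /=; rewrite coefZ coefXn eq_sym.
by case: (_ == _); case: all; rewrite /= ?mulr1 ?mulr0.
Qed.

Lemma horner_pcoef_poly f e s k v t : k \notin s ->
  (pcoef_poly f e s k v).[t] = pcoef f e s (upd v k t).
Proof.
move=> ks; rewrite horner_sum; apply: eq_bigr => m _.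
rewrite hornerZ hornerXn -mulrA; congr (_ * _).
rewrite [RHS](bigD1 k) //= mulrC {1}/upd eqxx; congr (_ * _).
apply: eq_big => [l|l]; first by rewrite inE negb_or andbC.
by rewrite inE negb_or /upd => /andP[/negbTE ->].
Qed.

Variable g : 'I_N -> nat -> F.
Hypothesis g_inj : forall k, injective (g k).

(** The remaining variables are moved into [s] one at a time: a polynomial in z_k vanishing on the
    infinite set of values of [g k] has all its coefficients zero. Once every variable is in [s],
    what is left is [f@_e]. *)
Lemma pcoef_grid0 f e s :
  (forall a : 'I_N -> nat, pcoef f e s (fun l => g l (a l)) = 0) -> f@_e = 0.
Proof.
move=> f0.
suff H r a : pcoef f e (undup (r ++ s)) (fun l => g l (a l)) = 0.
  rewrite -(pcoef_enum f e (fun l => g l 0%N)) -[RHS](H (enum 'I_N) (fun=> 0%N)).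
  by apply: eq_pcoef => k; rewrite mem_undup mem_cat [in RHS]mem_enum mem_enum.
elim: r a => [|k r IHr] a /=.
  by rewrite -[RHS](f0 a); apply: eq_pcoef => k; rewrite mem_undup.
case: ifPn => krs; first exact: IHr.
rewrite -coef_pcoef_poly; set p := pcoef_poly _ _ _ _ _.
suff -> : p = 0 by rewrite coef0.
apply: (poly0_inj_zeros (@g_inj k)) => n.
(* Setting z_k to [g k n] gives another grid point, so the induction hypothesis applies. *)
rewrite horner_pcoef_poly ?mem_undup // -[RHS](IHr (upd a k n)).
apply: eq_bigr => m _; congr (_ * _); apply: eq_bigr => l _.
by rewrite /upd; case: eqP => // ->.
Qed.

End PartialCoefficients.

Lemma meval_upd_notoccurs (F : comNzRingType) N (f : {mpoly F[N]}) k v t :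
  ~ occurs k f -> f.@[upd v k t] = f.@[v].
Proof.
move=> kf; rewrite !mevalE [LHS]big_seq [RHS]big_seq.
apply: eq_bigr => m mf; congr (_ * _); apply: eq_bigr => l _.
rewrite /upd; case: eqP => // ->; case: (posnP (m k)) => [->|mk].
  by rewrite !expr0.
case: kf; exists m; first by rewrite -mcoeff_msupp.
by rewrite lep1mP -lt0n.
Qed.

Lemma notoccurs_grid_neq0 (F : closedFieldType) N (f : {mpoly F[N]}) k
    (g : 'I_N -> nat -> F) :
  (forall l, injective (g l)) ->
  (forall a t, f.@[upd (fun l => g l (a l)) k t] != 0) -> ~ occurs k f.
Proof.
move=> g_inj fN0 [e fe]; rewrite lep1mP => ek.
case/eqP: fe; apply: (pcoef_grid0 g_inj (s := [:: k])) => a.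
rewrite -coef_pcoef_poly; set p := pcoef_poly _ _ _ _ _.
(* A root t of p would be a zero of f; without a root p is constant, and its coefficient of positive
   degree [e k] vanishes. *)
have [/closed_rootP[t] | ] := boolP (size p != 1).
  by rewrite rootE horner_pcoef_poly // pcoef_nil (negPf (fN0 a t)).
by rewrite negbK => /eqP p1; rewrite nth_default // p1 lt0n.
Qed.

Lemma symvar_eq n (i j p q : 'I_n) :
  (symvar p q == symvar i j) = ((p, q) == (i, j)) || ((p, q) == (j, i)).
Proof.
rewrite /symvar (inj_eq enum_rank_inj) -val_eqE /= /sort_pair !xpair_eqE.
by do 2![case: leqP => ?]; rewrite /= ?xpair_eqE -!val_eqE /=; lia.
Qed.

Lemma sym_eval_symvar (R : comNzRingType) n (f : sympoly R n)
    (v : 'I_(nb_symvar n) -> R) :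
  sym_eval f (\matrix_(p, q) v (symvar p q)) = f.@[v].
Proof.
apply: meval_eq => k /=; rewrite mxE; congr v.
apply: enum_val_inj; rewrite enum_rankK; apply: val_inj => /=.
by rewrite /sort_pair (valP (enum_val k)); case: (val _).
Qed.

(** The quadratic form at v is the sum of the squares of the entries of [C *m v], which is
    nonzero. *)
Lemma posdefmx_gram (R : realType) n (C : 'M[R]_n) :
  C \in unitmx -> posdefmx (C^T *m C).
Proof.
move=> Cu; split=> [|v v0]; first by rewrite trmx_mul trmxK.
have Cv0 : C *m v != 0.
  by apply: contraNneq v0 => Cv0; rewrite -(mulKmx Cu v) Cv0 mulmx0.
rewrite mulmxA -trmx_mul -mulmxA mxE lt_def sumr_ge0 ?andbT; last first.
  by move=> l _; rewrite mxE -expr2 sqr_ge0.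
apply: contra Cv0; rewrite psumr_eq0 => [/allP w0|l _]; last first.
  by rewrite mxE -expr2 sqr_ge0.
apply/eqP/matrixP => l c; rewrite ord1 [RHS]mxE.
by have := w0 l (mem_index_enum l); rewrite /= [(_^T) _ _]mxE mulf_eq0 orbb => /eqP ->.
Qed.

(** Assuming [i != j] instead of an order lets [symvarC] give both diagonal variables. *)
Lemma occurs_diag (R : realType) n (f : sympoly R[i] n) (i j : 'I_n) :
  psd_stable f -> i != j -> occurs (symvar i j) f -> occurs (symvar i i) f.
Proof.
move=> f_st ij ijf.
(* A search through the finite support decides the proposition [occurs]. *)
have [/hasP[m mf mi]|/hasPn iif] :=
    boolP (has (fun m : 'X_{1..nb_symvar n} => m (symvar i i) != 0) (msupp f)).
  by exists m; rewrite -?mcoeff_msupp ?lep1mP.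
have {iif} iiNf : ~ occurs (symvar i i) f.
  case=> m; rewrite -mcoeff_msupp lep1mP => /iif /negP; exact.
(* The real parts m make the grid infinite; the imaginary parts form the identity matrix. *)
pose g (l : 'I_(nb_symvar n)) (m : nat) : R[i] :=
  (m%:R +i* (let p := val (enum_val l) in (p.1 == p.2)%:R))%C.
exfalso; apply: (@notoccurs_grid_neq0 _ _ f (symvar i j) g) ijf.
  by move=> l m m' [] /eqP; rewrite eqr_nat => /eqP.
move=> a t; set v := upd _ _ _.
pose b := complex.Im t.
(* With M_ii = (1 + b^2) i, Im M is the Gram matrix of the columns of Id + b E_ji. *)
rewrite -(meval_upd_notoccurs v (0 +i* (1 + b ^+ 2))%C iiNf) -sym_eval_symvar.
apply: f_st; first by apply/matrixP => p q; rewrite !mxE symvarC.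
set A := map_mx _ _.
pose C : 'M[R]_n := 1%:M + b *: delta_mx j i.
(* As E_ji squares to zero, Id - b E_ji is the inverse of [C]. *)
have dd : delta_mx j i *m delta_mx j i = 0 :> 'M[R]_n.
  by rewrite mul_delta_mx_0.
have Cu : C \in unitmx.
  suff /mulmx1_unit[] : C *m (1%:M - b *: delta_mx j i) = 1%:M by [].
  rewrite mulmxBr mulmx1 -scalemxAr mulmxDl mul1mx -scalemxAl dd scaler0.
  by rewrite addr0 addrK.
suff -> : A = C^T *m C by apply: posdefmx_gram.
have -> : C^T *m C = 1%:M + b *: delta_mx i j + b *: delta_mx j i
                    + b ^+ 2 *: delta_mx i i.
  have -> : C^T = 1%:M + b *: delta_mx i j.
    by rewrite linearD linearZ /= trmx1 trmx_delta.
  rewrite mulmxDr mulmx1 mulmxDl mul1mx.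
  by rewrite -scalemxAl -scalemxAr mul_delta_mx scalerA !addrA.
apply/matrixP => p q; rewrite !mxE /v /upd.
rewrite !symvar_eq !xpair_eqE orbb.
have Im_g m : complex.Im (g (symvar p q) m) = (p == q)%:R.
  rewrite /g /symvar enum_rankK /= /sort_pair.
  by case: ifP => //= _; rewrite eq_sym.
have ji : j != i by rewrite eq_sym.
rewrite !(fun_if (@complex.Im R)) Im_g /= -/b.
(* Only the entries (i,i), (i,j) and (j,i) can differ from those of the identity. *)
have [->|pi] := eqVneq p i.
  have [->|qi] := eqVneq q i.
    by rewrite (negPf ij) /=; ring.
  by rewrite (negPf ij) /=; case: eqP => _ /=; ring.
have [->|pj] := eqVneq p j; last by rewrite /=; ring.
have [->|qi] := eqVneq q i; first by rewrite (negPf ji) /=; ring.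
by rewrite /=; ring.
Qed.

Theorem theorem5p1 (R : realType) (n : nat) (f : sympoly R[i] n) (i j : 'I_n) :
  psd_stable f -> (i < j)%N -> occurs (symvar i j) f ->
  occurs (symvar i i) f /\ occurs (symvar j j) f.
Proof.
move=> f_st lt_ij ijf; have ij : i != j by rewrite neq_ltn lt_ij.
split; first exact: occurs_diag ijf.
by apply: (occurs_diag (j := i)); rewrite // 1?eq_sym // symvarC.
Qed.
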